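(* Let $M$ be a loopless matroid of rank $r$ on $n$ elements. Then $F(M)\in V^n_r$. Moreover the expansion of $F(M)$ in terms of the basis elements $\mathcal{N}^n_r$ has only nonnegative integer coefficients.
   Context: A composition $\alpha=(\alpha_1,\dots,\alpha_m)$ is a finite (possibly empty) sequence of positive integers; $\ell(\alpha)=m$ is its length and $|\alpha|=\alpha_1+\cdots+\alpha_m$ its weight. The empty composition is denoted $\mathbf{0}$. The rank of $\alpha$ is $r(\alpha)=\alpha_1+\alpha_3+\alpha_5+\cdots$ (sum of odd-indexed parts). For compositions of the same weight $n$, $\beta$ refines $\alpha$ ($\beta\preccurlyeq\alpha$) if the set of proper partial sums of $\alpha$ (a subset of $\{1,\dots,n-1\}$) is contained in that of $\beta$. $\mathrm{QSym}$ is the ring of quasisymmetric functions in the ordered variables $x_1,x_2,\dots$, with monomial basis $\mathbf{x}^\alpha=\sum_{1\le i_1<\cdots<i_m}x_{i_1}^{\alpha_1}\cdots x_{i_m}^{\alpha_m}$ and fundamental basis $L_\alpha=\sum_{\beta\preccurlyeq\alpha}\mathbf{x}^\beta$ (with $L_{\mathbf 0}=1$). A permutation of a finite set $X$ of positive integers is a sequence $\pi$ listing each element of $X$ exactly once; $C(\pi)$ is the composition whose parts are the lengths of the successive maximal increasing runs of $\pi$. A labeled poset $P$ is a partial order $\le_P$ on a finite set of positive integers (the labels). $\mathcal{L}(P)$ is the set of linear extensions of $P$, i.e. permutations of the label set in which $x$ appears before $y$ whenever $x<_P y$. The quasisymmetric function of $P$ is $F(P)=\sum_{\pi\in\mathcal{L}(P)}L_{C(\pi)}$.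 A labeled poset is strictly labeled if $x<_P y$ implies $x>y$ as integers. $P\oplus Q$ denotes the ordinal sum of posets (all elements of $P$ lie below all elements of $Q$). For a nonempty composition $\alpha$ with $\ell(\alpha)=m$, let $P_\alpha=A_1\oplus\cdots\oplus A_m$, where $A_i$ is an antichain with $\alpha_i$ elements, labeled by $1,\dots,|\alpha|$ as follows: first the elements of $A_2,A_4,\dots$ are numbered consecutively, followed by the elements of $A_1,A_3,\dots$. Define $N_\alpha=F(P_\alpha)$, and $N_{\mathbf 0}=1$. The set $\{N_\alpha\}$ is a $\mathbb{Z}$-basis of $\mathrm{QSym}$. Set $\mathcal{N}^0_0=\{N_{\mathbf 0}\}=\{1\}$ and, for $1\le r\le n$, $\mathcal{N}^n_r=\{N_\alpha : |\alpha|=n,\ r(\alpha)=r\}$; $V^n_r$ is the span of $\mathcal{N}^n_r$ (the coefficient ring may be taken to be $\mathbb{Q}$ or $\mathbb{Z}$). For a matroid $M$ with ground set $E(M)$ and set of bases $\mathcal{B}(M)$, and $B\in\mathcal{B}(M)$, let $P_B$ be the poset on $E(M)$ in which $e<_{P_B}e'$ iff $e\in B$, $e'\in E(M)\setminus B$ and $(B\setminus\{e\})\cup\{e'\}\in\mathcal{B}(M)$; give $P_B$ any strict labeling ($F(P_B)$ does not depend on the choice). The quasisymmetric function of $M$ is $F(M)=\sum_{B\in\mathcal{B}(M)}F(P_B)$. *)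

(* Defs.v *)
From HB Require Import structures.
From mathcomp Require Import all_boot all_order all_algebra finmap.
From mathcomp Require Import boolp functions.

Set Implicit Arguments.
Unset Strict Implicit.
Unset Printing Implicit Defensive.

Import Order.TTheory GRing.Theory Num.Theory.
Local Open Scope ring_scope.

Definition is_composition (a : seq nat) : bool := all (leq 1) a.

(* The sum of the first, third, fifth, ... parts, which are at the even
   positions since nth counts from 0. *)
Definition comp_rank (a : seq nat) : nat :=
  (\sum_(i < size a | ~~ odd i) nth 0 a i)%N.

(* A composition of n + 1 either starts with a part 1, or is obtained from
   a nonempty composition of n by incrementing its first part. *)
Fixpoint compositions (n : nat) : seq (seq nat) :=
  if n is n'.+1 then
    [seq 1%N :: a | a <- compositions n'] ++
    [seq (head 0%N a).+1 :: behead a | a <- compositions n' & a != [::]]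
  else [:: [::]].

Lemma mem_compositions (n : nat) (a : seq nat) :
  (a \in compositions n) = is_composition a && (sumn a == n).
Proof.
elim: n a => [|n IHn] a.
  case: a => [|x a]; rewrite inE /= ?eqxx //; case: x => // x; rewrite addSn.
  by apply/esym/andP => -[].
rewrite /= mem_cat; apply/orP/idP.
  case=> /mapP[b].
    by rewrite IHn => /andP[cb /eqP sb] ->; rewrite /= cb add1n sb eqxx.
  rewrite mem_filter IHn; case: b => [|x b] //= /andP[/andP[_ cb] /eqP sb] ->.
  by rewrite /= cb addSn sb eqxx.
case: a => [|[|[|x]] a] //= /andP[ca]; rewrite !addSn eqSS => sa.
  by left; apply/mapP; exists a => //; rewrite IHn ca.
right; apply/mapP; exists (x.+1 :: a) => //.
by rewrite mem_filter /= IHn /= ca addSn.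
Qed.

Lemma compositions_uniq (n : nat) : uniq (compositions n).
Proof.
have cons1_inj : injective (cons 1%N) by move=> s t [->].
elim: n => //= n IHn; rewrite cat_uniq (map_inj_uniq cons1_inj) IHn.
rewrite map_inj_in_uniq ?filter_uniq //=.
  rewrite andbT; apply/hasPn => _ /mapP[b + ->].
  rewrite mem_filter mem_compositions; case: b => [|[|x] b] //= _.
  by apply/negP => /mapP[? _ []].
by move=> [|x a] [|y b]; rewrite !mem_filter //= => _ _ [-> ->].
Qed.

Definition partial_sums (a : seq nat) : seq nat :=
  [seq sumn (take i a) | i <- iota 1 (size a).-1].

Definition refines (b a : seq nat) : bool :=
  (sumn b == sumn a) && all (mem (partial_sums b)) (partial_sums a).

(* The variables are x_0, x_1, ...; a series maps the exponent vector of each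
   monomial to its coefficient. rat^o is rat as a module over itself. *)
Definition exponents : Type := {fsfun nat -> nat with 0%N}.

Definition series : Type := exponents -> rat^o.
HB.instance Definition _ := GRing.Lmodule.copy series (exponents -> rat^o).

Definition nonzero_exponents (e : exponents) : seq nat :=
  [seq e i | i <- sort leq (finsupp e)].

(* The coefficient of x_{i_1}^{e_1} ... x_{i_m}^{e_m}, with i_1 < ... < i_m
   and all e_k > 0, is 1 if (e_1, ..., e_m) = a and 0 otherwise. *)
Definition monomial_qsym (a : seq nat) : series :=
  fun e => (nonzero_exponents e == a)%:R.

Definition fundamental_qsym (a : seq nat) : series :=
  \sum_(b <- compositions (sumn a) | refines b a) monomial_qsym b.

Fact poset_display : Order.disp_t. Proof. exact: Order.Disp tt tt. Qed.

(* A poset on a set of positive integers is encoded as an abstract poset P with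
   an injective map w from P to the positive integers; w need not be monotone. *)
Definition labeling (T : Type) (w : T -> nat) : Prop :=
  injective w /\ forall x, (0 < w x)%N.

Definition strict_labeling d (P : porderType d) (w : P -> nat) : Prop :=
  labeling w /\ forall x y : P, (x < y)%O -> (w y < w x)%N.

Definition linear_extensions d (P : finPOrderType d) : {set #|P|.-tuple P} :=
  [set t : #|P|.-tuple P |
    uniq t && [forall x : P, forall y : P,
                 (x < y)%O ==> (index x t < index y t)%N]].

Definition prepend_to_runs (x : nat) (runs : seq (seq nat)) : seq (seq nat) :=
  match runs with
  | (y :: run) :: runs' =>
      if (x < y)%N then (x :: y :: run) :: runs' else [:: x] :: runs
  | _ => [:: x] :: runs
  end.

Definition increasing_runs (s : seq nat) : seq (seq nat) :=
  foldr prepend_to_runs [::] s.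

Definition run_composition (s : seq nat) : seq nat := shape (increasing_runs s).

Definition poset_qsym d (P : finPOrderType d) (w : P -> nat) : series :=
  \sum_(t in linear_extensions P) fundamental_qsym (run_composition (map w t)).

(* The element (i, j) is the j-th element of the antichain A_{i+1}. *)
Definition antichain_sum (a : seq nat) : predArgType :=
  {i : 'I_(size a) & 'I_(nth 0%N a i)}.
HB.instance Definition _ a := Finite.on (antichain_sum a).

Definition antichain_sum_lt (a : seq nat) : rel (antichain_sum a) :=
  fun x y => (tag x < tag y)%N.

Lemma antichain_sum_lt_irr a : irreflexive (@antichain_sum_lt a).
Proof. by move=> x; apply: ltnn. Qed.

Lemma antichain_sum_lt_trans a : transitive (@antichain_sum_lt a).
Proof. by move=> y x z; apply: ltn_trans. Qed.

HB.instance Definition _ a :=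
  Order.Lt_isPOrder.Build poset_display (antichain_sum a)
    (@antichain_sum_lt_irr a) (@antichain_sum_lt_trans a).

(* Labels 1, ..., |a|: first A_2, A_4, ... (odd i), then A_1, A_3, ... *)
Definition antichain_sum_label (a : seq nat) (x : antichain_sum a) : nat :=
  let i := tag x in
  ((if odd i then 0 else \sum_(k < size a | odd k) nth 0 a k)
   + \sum_(k < size a | (k < i) && (odd k == odd i)) nth 0 a k
   + tagged x).+1%N.

Definition N_qsym (a : seq nat) : series :=
  poset_qsym (@antichain_sum_label a).

(* The right-hand side is the constant series 1. *)
Lemma N_qsym_nil : N_qsym [::] = monomial_qsym [::].
Proof.
have c0 : #|antichain_sum [::]| = 0%N by apply: eq_card0 => -[[]].
rewrite /N_qsym /poset_qsym.
have e0 (t : #|antichain_sum [::]|.-tuple (antichain_sum [::])) :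
  tval t = [::] by apply: size0nil; rewrite size_tuple.
have t0 : size ([::] : seq (antichain_sum [::])) == #|antichain_sum [::]|.
  by rewrite c0.
rewrite (big_pred1 (Tuple t0)) => [|t] /=.
  by rewrite /fundamental_qsym big_cons big_nil addr0.
rewrite inE e0 /=; transitivity true; first by apply/forallP => -[[]].
by apply/esym/eqP/val_inj; rewrite /= e0.
Qed.

Definition N_combination (n r : nat) (c : seq nat -> rat) : series :=
  \sum_(a <- compositions n | comp_rank a == r) c a *: N_qsym a.

Definition V (n r : nat) (f : series) : Prop :=
  exists c : seq nat -> rat, f = N_combination n r c.

(* The ground set is the whole type E. *)
Record matroid (E : finType) := Matroid {
  bases : {set {set E}};
  bases_neq0 : bases != set0;
  bases_exchange : forall A B : {set E}, A \in bases -> B \in bases ->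
    forall x, x \in A :\: B ->
    exists2 y, y \in B :\: A & y |: (A :\ x) \in bases
}.

Definition indep (E : finType) (M : matroid E) (I : {set E}) : bool :=
  [exists B in bases M, I \subset B].

Definition matroid_rank (E : finType) (M : matroid E) : nat :=
  (\max_(I : {set E} | indep M I) #|I|)%N.

Definition loopless (E : finType) (M : matroid E) : Prop :=
  forall e, indep M [set e].

Definition basis_poset (E : finType) (M : matroid E) (B : {set E}) : predArgType := E.
HB.instance Definition _ E M B := Finite.on (@basis_poset E M B).

Definition basis_poset_lt (E : finType) (M : matroid E) (B : {set E}) :
    rel (basis_poset M B) :=
  fun e e' : E => [&& e \in B, e' \notin B & e' |: (B :\ e) \in bases M].

Lemma basis_poset_lt_irr (E : finType) (M : matroid E) B :
  irreflexive (@basis_poset_lt E M B).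
Proof. by move=> e; rewrite /basis_poset_lt; case: (e \in B). Qed.

Lemma basis_poset_lt_trans (E : finType) (M : matroid E) B :
  transitive (@basis_poset_lt E M B).
Proof. by move=> y x z /and3P[_ /negPf yNB _] /and3P[yB]; rewrite yB in yNB. Qed.

HB.instance Definition _ (E : finType) (M : matroid E) (B : {set E}) :=
  Order.Lt_isPOrder.Build poset_display (basis_poset M B)
    (@basis_poset_lt_irr E M B) (@basis_poset_lt_trans E M B).

(* w B is the labeling chosen for the poset of the basis B. *)
Definition matroid_qsym (E : finType) (M : matroid E)
    (w : forall B : {set E}, basis_poset M B -> nat) : series :=
  \sum_(B in bases M) poset_qsym (w B).

(* Main.v *)
From HB Require Import structures.
From mathcomp Require Import finmap boolp.
Require Import Defs.
From mathcomp Require Import all_boot all_order all_algebra.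
From mathcomp Require Import perm zify.

(** Write F(P) as the generating function of P-partitions. For the poset P_B
    with a strict labeling these are the maps f with f e < f e' whenever
    e <_{P_B} e'; for P_alpha they are the maps f with
    f(A_1) < f(A_2) <= f(A_3) < f(A_4) <= ...  Given a P_B-partition f, sort
    the ground set by f, breaking ties by putting the elements outside B first,
    and cut the sorted list whenever membership in B changes. The list starts
    in B because, M being loopless, every element outside B lies above some
    element of B. The blocks A_1, A_2, ... alternate between B and its
    complement, so that alpha_1 + alpha_3 + ... = |B|, and an ordered set
    partition occurs iff it is compatible with the order P_B; hence F(P_B) is a
    sum of N_alpha, one for each compatible ordered set partition.

    The coefficients are unique because the N_alpha are linearly independent:
    let the linear extension of P_beta that increases on the odd-numbered
    blocks and decreases on the even-numbered ones have run composition
    beta^*. Then L_{beta^*} occurs in N_beta, and it occurs in N_alpha only if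
    beta is dominated by alpha. *)

Set Implicit Arguments.
Unset Strict Implicit.
Unset Printing Implicit Defensive.

Import Order.TTheory GRing.Theory Num.Theory.

(** * Partial sums and runs *)

Lemma series_sumE (I : Type) (r : seq I) (Q : pred I) (F : I -> series) e :
  (\sum_(i <- r | Q i) F i)%R e = (\sum_(i <- r | Q i) F i e)%R.
Proof. by elim/big_rec2: _ => // i y1 y2 _ <-. Qed.

Lemma partial_sums_cons x y a :
  partial_sums (x :: y :: a) = x :: [seq x + z | z <- partial_sums (y :: a)].
Proof.
rewrite /partial_sums /= addn0; congr cons.
rewrite (iotaDl 1 1) -!map_comp; apply: eq_map => i /=.
by [].
Qed.

Lemma mem_partial_sumsP a k :
  reflect (exists2 j, 0 < j < size a & sumn (take j a) = k)
          (k \in partial_sums a).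
Proof.
apply: (iffP mapP) => -[j]; rewrite ?mem_iota => ltj eqk; exists j => //.
  by move: ltj; lia.
by rewrite mem_iota; move: ltj; lia.
Qed.

Lemma leq_sumn_take a j : sumn (take j a) <= sumn a.
Proof. by rewrite -{2}(cat_take_drop j a) sumn_cat leq_addr. Qed.

Lemma sumn_take_mono a i j : i <= j -> sumn (take i a) <= sumn (take j a).
Proof. by move=> le_ij; rewrite -(take_takel a le_ij) leq_sumn_take. Qed.

Lemma sumn_takeS a j :
  sumn (take j.+1 a) = sumn (take j a) + nth 0 a j.
Proof. by elim: a j => [|x a IHa] [|j] //=; rewrite ?take0 ?IHa /=; lia. Qed.

Lemma composition_nth_gt0 a j : is_composition a -> j < size a -> 0 < nth 0 a j.
Proof. by move=> /allP ca ltj; apply/ca/mem_nth. Qed.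

Lemma partial_sums_bounds a k : is_composition a -> k \in partial_sums a ->
  0 < k < sumn a.
Proof.
move=> ca /mem_partial_sumsP[j /andP[j0 ltj] <-].
have := composition_nth_gt0 ca ltj.
have := composition_nth_gt0 ca (ltn_trans j0 ltj).
have := leq_sumn_take a j.+1; rewrite sumn_takeS.
by have := sumn_take_mono a j0; rewrite (sumn_takeS a 0) take0 /=; lia.
Qed.

(** Inside a block [R] holds at every step and between consecutive blocks it fails, so the cuts can
    be read off the flattened word. It is applied with [ltn] to increasing runs and with equality to
    constant blocks. *)
Lemma partial_sums_blocks (R : rel nat) (rs : seq (seq nat)) :
    all (fun r => r != [::]) rs -> all (sorted R) rs ->
    sorted (fun r1 r2 => ~~ R (last 0 r1) (head 0 r2)) rs ->
  forall k, 0 < k < size (flatten rs) ->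
  (k \in partial_sums (shape rs)) =
    ~~ R (nth 0 (flatten rs) k.-1) (nth 0 (flatten rs) k).
Proof.
elim: rs => [|r rs IHrs] /=; first by move=> _ _ _ k; lia.
move=> /andP[r0 rs0] /andP[sr srs] prs k /andP[k0].
case: rs => [|r' rs] in rs0 srs prs IHrs *.
  rewrite cats0 => ltk /=; apply/esym/negbTE; rewrite negbK.
  by have /(_ k.-1) := (elimT (sortedP 0) sr); rewrite prednK //; apply.
move: prs => /= /andP[br prs]; move: rs0 => /= /andP[r'0 rs0].
rewrite partial_sums_cons inE size_cat !(nth_cat 0 r) => ltk.
have ps_gt0 z : z \in partial_sums (shape (r' :: rs)) -> 0 < z.
  move=> zps; have /partial_sums_bounds : is_composition (shape (r' :: rs)).
    rewrite /is_composition /shape all_map; apply/allP => u.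
    rewrite inE => /predU1P[-> /=|urs /=]; rewrite lt0n size_eq0 //.
    by move/allP: rs0 => /(_ _ urs).
  by move/(_ _ zps) => /andP[].
have -> : k.-1 < size r = (k <= size r) by lia.
(* The position [k] lies inside the first block, beyond its end (induction), or exactly at its
   end. *)
have [ltkr|ltrk|eqk] := ssrnat.ltngtP k (size r); rewrite ?orbF /=.
- apply/idP/idP.
    by case/mapP => z _ eqk; exfalso; lia.
  move=> /negP nR; case: nR; have /(_ k.-1) := elimT (sortedP 0) sr.
  by rewrite prednK //; apply.
- rewrite -[k in LHS](subnKC (ltnW ltrk)) mem_map; last exact: addnI.
  rewrite IHrs //=; first by rewrite (_ : (k - size r).-1 = k.-1 - size r); lia.
  - by rewrite r'0.
  - by move: ltk; rewrite size_cat /=; lia.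
- rewrite eqk subnn nth_last; move: br; case: r' r'0 {IHrs ltk ps_gt0 srs prs} => //=.
Qed.

Lemma increasing_runsP s :
  [/\ flatten (increasing_runs s) = s,
      all (fun r => r != [::]) (increasing_runs s),
      all (sorted ltn) (increasing_runs s) &
      sorted (fun r1 r2 => ~~ (last 0 r1 < head 0 r2)) (increasing_runs s)].
Proof.
elim: s => //= x s; case: (increasing_runs s) => [|[|y r] rs] [] //= <- rs0 srs brs //.
case: ltnP => lt_xy /=; split=> //; rewrite ?lt_xy ?srs -?leqNgt ?lt_xy //.
by case: rs brs {rs0 srs}.
Qed.

Lemma run_composition_comp s : is_composition (run_composition s).
Proof.
have [_ rs0 _ _] := increasing_runsP s.
rewrite /is_composition /run_composition /shape all_map.
by apply: sub_all rs0 => r /=; rewrite lt0n size_eq0.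
Qed.

Lemma sumn_run_composition s : sumn (run_composition s) = size s.
Proof.
by have [fl_s _ _ _] := increasing_runsP s; rewrite -[in RHS]fl_s size_flatten.
Qed.

Lemma mem_partial_sums_run s k : 0 < k < size s ->
  (k \in partial_sums (run_composition s)) = ~~ (nth 0 s k.-1 < nth 0 s k).
Proof.
have [fl_s rs0 srs brs] := increasing_runsP s.
by rewrite -[in size s]fl_s => /(partial_sums_blocks rs0 srs brs) ->; rewrite fl_s.
Qed.

(** Used in two ways: with exponents as multiplicities it encodes a monomial, with the parts of a
    composition it lists block indices. *)
Definition repeat_word (m : nat -> nat) (v : seq nat) : seq nat :=
  flatten [seq nseq (m i) i | i <- v].

Lemma shape_repeat_word (m : nat -> nat) (v : seq nat) :
  shape [seq nseq (m i) i | i <- v] = map m v.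
Proof. by rewrite /shape -map_comp; apply: eq_map => i /=; rewrite size_nseq. Qed.

Lemma size_repeat_word m v : size (repeat_word m v) = sumn (map m v).
Proof. by rewrite /repeat_word size_flatten shape_repeat_word. Qed.

Lemma mem_repeat_word m v i : i \in repeat_word m v -> i \in v.
Proof. by case/flatten_mapP => j jv; rewrite mem_nseq => /andP[_ /eqP->]. Qed.

Lemma count_repeat_word m v i : uniq v ->
  count_mem i (repeat_word m v) = if i \in v then m i else 0.
Proof.
rewrite /repeat_word; elim: v => //= j v IHv /andP[jv uv].
rewrite count_cat IHv // count_nseq in_cons /= eq_sym.
by case: eqVneq jv => [<-|_] /= jv; rewrite ?(negbTE jv) ?mul1n ?addn0 ?mul0n ?add0n.
Qed.

Lemma sorted_repeat_word m v : sorted leq v -> sorted leq (repeat_word m v).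
Proof.
rewrite !(sorted_pairwise leq_trans) /repeat_word.
elim: v => //= i v IHv /andP[/allP iv sv].
rewrite pairwise_cat IHv // andbT; apply/andP; split.
  apply/allrelP => x y; rewrite mem_nseq => /andP[_ /eqP->].
  by move/mem_repeat_word => /iv.
elim: (m i) => //= k ->; rewrite andbT; apply/allP => x.
by rewrite mem_nseq => /andP[_ /eqP->].
Qed.

Lemma mem_partial_sums_repeat m v k : sorted ltn v -> all (fun i => 0 < m i) v ->
    0 < k < size (repeat_word m v) ->
  (k \in partial_sums (map m v)) =
    (nth 0 (repeat_word m v) k.-1 != nth 0 (repeat_word m v) k).
Proof.
move=> sv mv; rewrite -shape_repeat_word => ltk.
apply: (@partial_sums_blocks eq_op _ _ _ _ k ltk).
- by rewrite all_map; apply: sub_all mv => i /=; case: (m i).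
- rewrite all_map; apply/allP => i _ /=.
  by elim: (m i) => //= -[|j] //= ->; rewrite eqxx.
- elim: v sv mv {ltk} => //= i [|j v] IHv //= /andP[ij sv] /and3P[mi mj mv].
  have /= -> := IHv sv; rewrite ?mj //= andbT.
  case: (m i) mi => // {}mi _; case: (m j) mj => // {}mj _ /=.
  by rewrite (_ : last _ _ = i) ?ltn_eqF //; elim: (mi).
Qed.

(** A monomial as the weakly increasing word of its variable indices; for instance [x_1^2 x_3]
    becomes [1, 1, 3]. *)
Definition exponent_word (e : exponents) : seq nat :=
  repeat_word e (sort leq (finsupp e)).

Lemma exponent_word_sorted e : sorted leq (exponent_word e).
Proof. by apply/sorted_repeat_word/sort_sorted/leq_total. Qed.

Lemma nonzero_exponents_comp e : is_composition (nonzero_exponents e).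
Proof.
rewrite /is_composition all_map; apply/allP => i /=.
by rewrite mem_sort mem_finsupp lt0n.
Qed.

Lemma sumn_nonzero_exponents e : sumn (nonzero_exponents e) = size (exponent_word e).
Proof. by rewrite size_repeat_word. Qed.

Lemma mem_partial_sums_exponents e k : 0 < k < size (exponent_word e) ->
  (k \in partial_sums (nonzero_exponents e)) =
    (nth 0 (exponent_word e) k.-1 != nth 0 (exponent_word e) k).
Proof.
move=> ltk; rewrite mem_partial_sums_repeat //.
  by rewrite ltn_sorted_uniq_leq sort_uniq fset_uniq sort_sorted //; exact: leq_total.
by rewrite -[all _ _](all_map e (leq 1)); exact: nonzero_exponents_comp.
Qed.

(** A monomial occurs in exactly one monomial quasisymmetric function, so at most one term of the
    defining sum is nonzero. *)
Lemma fundamental_qsymE a e :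
  fundamental_qsym a e = (refines (nonzero_exponents e) a)%:R%R.
Proof.
rewrite /fundamental_qsym series_sumE /monomial_qsym -big_filter.
set b := nonzero_exponents e; set s := filter _ _.
have us : uniq s by rewrite filter_uniq ?compositions_uniq.
have bs : (b \in s) = refines b a.
  rewrite mem_filter mem_compositions nonzero_exponents_comp /=.
  by rewrite /refines; case: (sumn b == _); rewrite ?andbT ?andbF.
rewrite -bs; have [ins|nins] := boolP (b \in s).
  rewrite (bigD1_seq b) //= eqxx big1 ?addr0 // => c.
  by rewrite eq_sym => /negbTE ->.
rewrite big_seq big1 // => c cs; case: eqP => // bc.
by rewrite bc cs in nins.
Qed.

(** * Lexicographic order on pairs of a value and a label *)

Definition lexlt (p q : nat * nat) : bool :=
  (p.1 < q.1) || (p.1 == q.1) && (p.2 < q.2).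

Definition lexle (p q : nat * nat) : bool :=
  (p.1 < q.1) || (p.1 == q.1) && (p.2 <= q.2).

Lemma lexle_trans : transitive lexle.
Proof. by move=> [? ?] [? ?] [? ?]; rewrite /lexle /=; lia. Qed.

Lemma lexlt_trans : transitive lexlt.
Proof. by move=> [? ?] [? ?] [? ?]; rewrite /lexlt /=; lia. Qed.

Lemma lexle_total : total lexle.
Proof. by move=> [? ?] [? ?]; rewrite /lexle /=; lia. Qed.

Lemma lexle_anti : antisymmetric lexle.
Proof. by move=> [a b] [c d]; rewrite /lexle /= => ?; congr pair; lia. Qed.

Lemma lexltW p q : lexlt p q -> lexle p q.
Proof. by rewrite /lexle /lexlt; lia. Qed.

Lemma lexltNge p q : lexlt p q = ~~ lexle q p.
Proof. by rewrite /lexle /lexlt; lia. Qed.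

Lemma lexlt_neqAle p q : lexlt p q = (p != q) && lexle p q.
Proof. by case: p q => a b [c d]; rewrite /lexle /lexlt xpair_eqE /=; lia. Qed.

(** Refinement forces the exponent word to increase strictly at each descent of [u]. Since this word
    increases weakly anyway, that amounts to a lexicographic increase of the pairs. *)
Lemma refines_run_composition e u :
  refines (nonzero_exponents e) (run_composition u) =
    (size (exponent_word e) == size u) && sorted lexlt (zip (exponent_word e) u).
Proof.
rewrite /refines sumn_nonzero_exponents sumn_run_composition.
case: eqP => //= eq_sz; set s := exponent_word e in eq_sz *.
have ltk k x : x = (0, 0) -> k < size u -> nth x (zip s u) k = (nth 0 s k, nth 0 u k).
  by move=> -> _; rewrite nth_zip.
apply/allP/(sortedP (0, 0)) => [ref k|srt k ps_k].
  rewrite size_zip eq_sz minnn => ltku; rewrite !ltk //; last exact: ltnW.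
  have : k.+1 \in partial_sums _ -> k.+1 \in partial_sums _ := ref k.+1.
  rewrite mem_partial_sums_run // mem_partial_sums_exponents ?eq_sz //=.
  have := sorted_leq_nth leq_trans leqnn 0 (exponent_word_sorted e) k k.+1.
  rewrite !inE -/s eq_sz => /(_ (ltnW ltku) ltku (leqnSn _)).
  by rewrite /lexlt /=; lia.
have := partial_sums_bounds (run_composition_comp u) ps_k.
rewrite sumn_run_composition => ltku; move: ps_k.
rewrite mem_partial_sums_run // => nlt.
suff : k \in partial_sums (nonzero_exponents e) by [].
rewrite mem_partial_sums_exponents ?eq_sz //.
have := srt k.-1; rewrite size_zip eq_sz minnn prednK; last by case/andP: ltku.
case/andP: ltku => k0 ltku; rewrite !ltk //; last by lia.
by move/(_ ltku); rewrite /lexlt /= (negbTE nlt) andbF orbF -/s neq_ltn => ->.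
Qed.

(** * P-partitions *)

Lemma perm_tuple_enum (P : finType) (t : #|P|.-tuple P) :
  uniq t -> perm_eq t (enum P).
Proof.
move=> ut; apply: uniq_perm => //; first exact: enum_uniq.
have sub : {subset t <= enum P} by move=> x _; rewrite mem_enum.
by have [|_] := uniq_min_size ut sub; first by rewrite -cardE size_tuple.
Qed.

Section LexSort.
Variables (P : finType) (p q : P -> nat).

Let key x := (p x, q x).

(** With the labels as [q] this turns a P-partition into its linear extension; with [zigzag_key] it
    will give one particular extension of [P_a]. *)
Definition lexsort : #|P|.-tuple P :=
  [tuple of sort (relpre key lexle) (enum P)].

Lemma perm_lexsort : perm_eq lexsort (enum P).
Proof. by rewrite perm_sort. Qed.

Lemma lexsort_uniq : uniq lexsort.
Proof. by rewrite (perm_uniq perm_lexsort) enum_uniq. Qed.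

Lemma mem_lexsort x : x \in tval lexsort.
Proof. by rewrite (perm_mem perm_lexsort) mem_enum. Qed.

Lemma lexsort_sorted : injective key -> sorted (relpre key lexlt) lexsort.
Proof.
move=> key_inj.
have : sorted (relpre key lexle) lexsort.
  by apply: sort_sorted => x y; exact: lexle_total.
have le_tr : transitive (relpre key lexle) by move=> y x z; apply: lexle_trans.
have lt_tr : transitive (relpre key lexlt) by move=> y x z; apply: lexlt_trans.
rewrite (sorted_pairwise le_tr) (sorted_pairwise lt_tr).
have := lexsort_uniq; elim: (tval lexsort) => //= x t IHt /andP[xt ut] /andP[xle st].
rewrite IHt // andbT; apply/allP => y yt; have /= xy := allP xle y yt.
rewrite /= lexlt_neqAle xy andbT.
by apply: contraNneq xt => /key_inj ->.
Qed.

Lemma eq_lexsort (t : #|P|.-tuple P) : injective key -> uniq t ->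
  sorted (relpre key lexlt) t -> t = lexsort.
Proof.
move=> key_inj ut st; apply/val_inj/(@sorted_eq _ (relpre key lexle)).
- by move=> y x z; apply: lexle_trans.
- by move=> x y /lexle_anti /key_inj.
- by apply: sub_sorted st => x y; exact: lexltW.
- by apply: sort_sorted => x y; exact: lexle_total.
by rewrite (perm_trans (perm_tuple_enum ut)) // perm_sym perm_lexsort.
Qed.

Lemma lexsort_index : injective key -> forall x y,
  (index x lexsort < index y lexsort) = lexlt (key x) (key y).
Proof.
move=> key_inj x y; have lt_tr : transitive (relpre key lexlt).
  by move=> ? ? ?; apply: lexlt_trans.
have idx := sorted_ltn_index lt_tr (lexsort_sorted key_inj).
apply/idP/idP => [|lt_xy]; first by apply: idx; exact: mem_lexsort.
rewrite ltnNge leq_eqVlt; apply/negP => /predU1P[eq_yx|/idx lt_yx].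
  have eq_xy : y = x.
    by rewrite -(nth_index x (mem_lexsort y)) eq_yx nth_index ?mem_lexsort.
  by move: lt_xy; rewrite eq_xy lexltNge /lexle eqxx leqnn orbT.
have := lt_yx (mem_lexsort _) (mem_lexsort _).
by rewrite /= lexltNge (lexltW lt_xy).
Qed.

Lemma map_lexsort_sorted : sorted leq (map p lexsort).
Proof.
rewrite sorted_map; apply: (@sub_sorted _ (relpre key lexle)).
  by move=> x y; rewrite /lexle /=; lia.
by apply: sort_sorted => x y; exact: lexle_total.
Qed.

Lemma map_lexsort s : sorted leq s -> perm_eq (map p (enum P)) s ->
  map p lexsort = s.
Proof.
move=> ss ps; apply: (sorted_eq leq_trans anti_leq map_lexsort_sorted ss).
by rewrite (perm_trans _ ps) // perm_map // perm_lexsort.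
Qed.

End LexSort.

(** P-partitions, cells and strict maps all have this shape. Prescribing the multiset [s] of values
    isolates one monomial; the bound [K] makes the set finite and only has to exceed the letters of
    [s]. *)
Definition constrained_maps (E : finType) (C : E -> E -> rel nat)
    (s : seq nat) (K : nat) :=
  [set f : {ffun E -> 'I_K} | perm_eq [seq val (f x) | x <- enum E] s
     && [forall x, forall y, C x y (f x) (f y)]].

(** The usual (P, w)-partitions: the lexicographic condition means [f x <= f y], with strict
    inequality unless the label increases. *)
Definition ppartitions d (P : finPOrderType d) (w : P -> nat) :=
  constrained_maps (fun x y i j => (x < y)%O ==> lexlt (i, w x) (j, w y)).

Lemma lex_key_inj (T : Type) (p w : T -> nat) : injective w ->
  injective (fun x => (p x, w x)).
Proof. by move=> w_inj x y [_ /w_inj]. Qed.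

(* Stanley's fundamental theorem of P-partitions; a P-partition [f] corresponds
   to the linear extension sorting P by [f], ties being broken by the labels. *)
Lemma poset_qsymE d (P : finPOrderType d) (w : P -> nat) K (e : exponents) :
    injective w -> all (fun v => v < K) (exponent_word e) ->
  poset_qsym w e = (#|ppartitions w (exponent_word e) K|)%:R%R.
Proof.
move=> w_inj; set s := exponent_word e => sK.
rewrite /poset_qsym series_sumE.
under eq_bigr => t _ do
  rewrite fundamental_qsymE refines_run_composition size_map size_tuple.
rewrite -/s.
pose h (f : {ffun P -> 'I_K}) := lexsort (val \o f) w.
have key_inj (f : {ffun P -> 'I_K}) : injective (fun x => ((val \o f) x, w x)).
  exact: lex_key_inj.
have h_s f : f \in ppartitions w s K -> map (val \o f) (h f) = s.
  rewrite inE => /andP[fs _]; apply: map_lexsort fs; exact: exponent_word_sorted.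
have h_inj : {in ppartitions w s K &, injective h}.
  move=> f g fP gP hfg; apply/ffunP => x; apply: val_inj.
  have := h_s g gP; rewrite -hfg -(h_s f fP) => /eq_in_map /(_ x) /= -> //.
  exact: mem_lexsort.
rewrite -(card_in_imset h_inj) -sum1_card natr_sum.
(* Extensions in the image of [h] contribute 1 each; all others will be shown to contribute 0. *)
rewrite (bigID (fun t => t \in h @: ppartitions w s K)) /= [X in (_ + X)%R]big1 => [|t].
  rewrite addr0; apply: eq_big => [t|t /andP[_ /imsetP[f fP ->]]].
    apply/andb_idl => /imsetP[f fP ->]; move: (fP); rewrite !inE => /andP[_ fle].
    rewrite lexsort_uniq; apply/forallP => x; apply/forallP => y; apply/implyP => lt_xy.
    rewrite lexsort_index //.
    by move/forallP: fle => /(_ x) /forallP /(_ y) /implyP; apply.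
  have zip_eq : zip s [seq w x | x <- h f] = [seq (val (f x), w x) | x <- h f].
    by rewrite -(h_s f fP) zip_map.
  rewrite zip_eq sorted_map lexsort_sorted; last exact: key_inj.
  rewrite andbT -(h_s f fP) size_map size_tuple.
  by rewrite eqxx.
case/andP => tL; apply: contraNeq; rewrite pnatr_eq0 eqb0 negbK => /andP[/eqP sz_s st].
have ut : uniq t by move: tL; rewrite inE => /andP[].
have tP x : x \in tval t by rewrite (perm_mem (perm_tuple_enum ut)) mem_enum.
(* A contributing extension comes from the map that gives [x] the letter of [s] at the position of
   [x] in [t]. *)
have ltK x : nth 0 s (index x t) < K.
  by move/allP: sK; apply; rewrite mem_nth // sz_s -[X in _ < X](size_tuple t) index_mem.
pose f := [ffun x => Ordinal (ltK x)].
have map_f : map (val \o f) t = s.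
  apply: (@eq_from_nth _ 0) => [|i]; rewrite size_map ?size_tuple // => lti.
  have /card_gt0P[x0 _] : 0 < #|P| by exact: leq_ltn_trans lti.
  by rewrite (nth_map x0) ?size_tuple //= ffunE /= index_uniq ?size_tuple.
have th : t = h f.
  apply: eq_lexsort => //; move: st; rewrite -map_f zip_map sorted_map.
  by apply: sub_sorted => x y.
rewrite th imset_f // inE; apply/andP; split.
  rewrite -map_f perm_sym; apply: perm_map; exact: perm_tuple_enum.
apply/forallP => x; apply/forallP => y; apply/implyP => lt_xy.
have := lexsort_index (key_inj f) x y => <-; rewrite -/(h f) -th.
by move: tL; rewrite inE => /andP[_ /forallP /(_ x) /forallP /(_ y) /implyP]; apply.
Qed.

(** * The posets P_alpha *)

(** The number of labels handed out before the block of index [i]; indices start at 0, so odd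
    indices are numbered first. *)
Definition label_offset (a : seq nat) (i : nat) : nat :=
  (if odd i then 0 else \sum_(k < size a | odd k) nth 0 a k)
  + \sum_(k < size a | (k < i) && (odd k == odd i)) nth 0 a k.

(** The sum for [j] contains all terms for [i] and the term [i] itself. With the next lemma, the
    blocks occupy disjoint intervals of labels. *)
Lemma label_offset_same a i j : i < j -> odd i = odd j ->
  label_offset a i + nth 0 a i <= label_offset a j.
Proof.
rewrite /label_offset => lt_ij oij; rewrite oij -addnA leq_add2l.
have [lei|lti] := leqP (size a) i.
  rewrite nth_default // addn0; apply/eq_leq/eq_bigl => k; congr (_ && _).
  by have := ltn_ord k; lia.
rewrite [leqRHS](bigD1 (Ordinal lti)) /=; last by rewrite lt_ij oij eqxx.
rewrite addnC leq_add2l.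
rewrite [leqRHS](bigID (fun k : 'I__ => k < i)) /=.
apply: leq_trans (leq_addr _ _); apply/eq_leq/eq_bigl => k.
by rewrite -val_eqE /=; lia.
Qed.

Lemma label_offset_odd_even a i j : odd i -> ~~ odd j ->
  label_offset a i + nth 0 a i <= label_offset a j.
Proof.
rewrite /label_offset => oi oj; rewrite oi (negbTE oj) add0n.
apply: leq_trans (leq_addr _ _).
have [lei|lti] := leqP (size a) i.
  rewrite nth_default // addn0 [leqRHS](bigID (fun k : 'I__ => k < i)) /=.
  by apply: leq_trans (leq_addr _ _); apply/eq_leq/eq_bigl => k; lia.
rewrite [leqRHS](bigD1 (Ordinal lti)) //= addnC leq_add2l.
rewrite [leqRHS](bigID (fun k : 'I__ => k < i)) /=.
apply: leq_trans (leq_addr _ _); apply/eq_leq/eq_bigl => k.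
by rewrite -val_eqE /=; lia.
Qed.

Section AntichainSum.
Variable a : seq nat.
Implicit Types x y : antichain_sum a.

Lemma antichain_sum_labelE x :
  antichain_sum_label x = (label_offset a (tag x) + tagged x).+1.
Proof. by []. Qed.

Lemma antichain_sum_label_same_tag x y : tag x = tag y ->
  (antichain_sum_label x < antichain_sum_label y) = (tagged x < tagged y).
Proof.
move=> eq_tag; rewrite !antichain_sum_labelE.
have -> : label_offset a (tag x) = label_offset a (tag y) by rewrite eq_tag.
by rewrite ltnS ltn_add2l.
Qed.

(** Odd indices being numbered first, a label drops along the order only from an even to an odd
    index. This is the origin of the pattern [f(A_1) < f(A_2) <= f(A_3) < ...]. *)
Lemma antichain_sum_label_lt x y : tag x < tag y ->
  if ~~ odd (tag x) && odd (tag y)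
  then antichain_sum_label y < antichain_sum_label x
  else antichain_sum_label x < antichain_sum_label y.
Proof.
move=> lt_xy; have ltx := ltn_ord (tagged x); have lty := ltn_ord (tagged y).
rewrite !antichain_sum_labelE.
have := @label_offset_same a _ _ lt_xy.
have := @label_offset_odd_even a (tag x) (tag y).
have := @label_offset_odd_even a (tag y) (tag x).
move: ltx lty; case: (odd (tag x)); case: (odd (tag y)) => /= ltx lty.
- by move=> _ _ /(_ erefl); lia.
- by move=> _ /(_ isT isT); lia.
- by move=> /(_ isT isT); lia.
- by move=> _ _ /(_ erefl); lia.
Qed.

Lemma antichain_sum_eq x y : tag x = tag y -> tagged x = tagged y :> nat -> x = y.
Proof.
case: x y => i u [j v] /= eq_ij; case: _ / eq_ij v => v /val_inj eq_uv.
by rewrite eq_uv.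
Qed.

Lemma antichain_sum_label_inj : injective (@antichain_sum_label a).
Proof.
move=> x y eq_xy; have eq_tag : tag x = tag y.
  apply/val_inj; have [||//] := ssrnat.ltngtP (tag x) (tag y).
    by move/antichain_sum_label_lt; rewrite eq_xy ltnn if_same.
  by move/antichain_sum_label_lt; rewrite eq_xy ltnn if_same.
apply: antichain_sum_eq => //; move: eq_xy; rewrite !antichain_sum_labelE.
have -> : label_offset a (tag x) = label_offset a (tag y) by rewrite eq_tag.
by move=> []; apply: addnI.
Qed.

Lemma card_antichain_sum_tag i :
  #|[set x : antichain_sum a | tag x == i :> nat]| = nth 0 a i.
Proof.
have [lti|lei] := ltnP i (size a); last first.
  rewrite nth_default //; apply/eqP; rewrite cards_eq0; apply/eqP/setP => x.
  by rewrite !inE; apply/negbTE; rewrite neq_ltn (leq_trans (ltn_ord _) lei).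
pose t (j : 'I_(nth 0 a i)) : antichain_sum a := existT _ (Ordinal lti) j.
have t_inj : injective t.
  by move=> j k /eqP; rewrite eq_Tagged /= => /eqP.
rewrite -[RHS]card_ord -cardsT -(card_imset _ t_inj); apply: eq_card => x.
rewrite inE; apply/eqP/imsetP => [|[j _ ->] //]; case: x => k u /= eq_ki.
have eq_k : k = Ordinal lti by apply: val_inj.
by case: _ / (esym eq_k) u => u; exists u.
Qed.

End AntichainSum.

(** The P-partitions of [P_a] carried over to a set [E] whose blocks are the fibres of [g], so that
    different compositions can be compared on one ground set. *)
Definition cell (E : finType) (g : E -> nat) :=
  constrained_maps (fun x y i j => (g x < g y) ==>
    if ~~ odd (g x) && odd (g y) then i < j else i <= j).

Lemma N_qsymE a K (e : exponents) :
    all (fun v => v < K) (exponent_word e) ->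
  N_qsym a e =
    (#|cell (fun x : antichain_sum a => tag x : nat) (exponent_word e) K|)%:R%R.
Proof.
move=> sK; rewrite /N_qsym (poset_qsymE (@antichain_sum_label_inj a) sK).
congr (_%:R)%R; apply: eq_card => f; rewrite !inE; congr (_ && _).
apply: eq_forallb => x; apply: eq_forallb => y.
have -> : (x < y)%O = (tag x < tag y) by [].
apply: implyb_id2l => /antichain_sum_label_lt; rewrite /lexlt /=.
case: ifP => _ lt_xy; first by rewrite (leq_gtF (ltnW lt_xy)) andbF orbF.
by rewrite lt_xy andbT [in RHS]leq_eqVlt orbC.
Qed.

(** Equal fibre sizes make the two lists of values permutations of each other; the permutation of
    positions is the bijection. *)
Lemma perm_map_enum_bij (E E' : finType) (g : E -> nat) (g' : E' -> nat) :
    (forall i, #|[set x | g x == i]| = #|[set x | g' x == i]|) ->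
  exists2 phi : E -> E', bijective phi & forall x, g' (phi x) = g x.
Proof.
move=> eq_fib.
have count_fib (T : finType) (h : T -> nat) i :
    count_mem i (map h (enum T)) = #|[set x | h x == i]|.
  rewrite count_map cardE -size_filter; congr size; rewrite enumT.
  by apply: eq_filter => x; rewrite /= inE.
have perm_gg' : perm_eq (map g (enum E)) (map g' (enum E')).
  by apply/allP => i _; rewrite /= !count_fib eq_fib.
have eq_card : #|E'| = #|E|.
  by rewrite !cardE -(size_map g) -(size_map g'); apply/esym/perm_size.
pose T := [tuple of map g (enum E)].
pose T' := tcast eq_card [tuple of map g' (enum E')].
have /tuple_permP[p eq_p] : perm_eq T T' by rewrite val_tcast.
exists (fun x => enum_val (cast_ord (esym eq_card) (p (enum_rank x)))).
  apply: inj_card_bij; last by rewrite eq_card.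
  by move=> x y /enum_val_inj /cast_ord_inj /perm_inj /enum_rank_inj.
move=> x; have := congr1 (fun s => nth 0 s (enum_rank x)) eq_p.
rewrite /= (nth_map x) -?cardE // nth_enum_rank => ->.
rewrite -[map _ (enum _)]/(val [tuple tnth T' (p i) | i < #|E|]) -tnth_nth tnth_mktuple.
rewrite tcastE (tnth_nth 0) /=.
rewrite (nth_map (enum_val (cast_ord (esym eq_card) (p (enum_rank x))))) -?cardE //.
by congr g'; apply: enum_val_nth.
by rewrite eq_card ltn_ord.
Qed.

Lemma card_constrained_maps_bij (E E' : finType) (phi : E -> E') C C' s K :
    bijective phi -> (forall x y i j, C' (phi x) (phi y) i j = C x y i j) ->
  #|constrained_maps C s K| = #|constrained_maps C' s K|.
Proof.
move=> [psi phiK psiK] C'phi.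
pose h (f : {ffun E' -> 'I_K}) : {ffun E -> 'I_K} := [ffun x => f (phi x)].
have h_bij : bijective h.
  exists (fun f : {ffun E -> 'I_K} => [ffun y => f (psi y)]) => f;
    apply/ffunP => x; rewrite !ffunE.
    by rewrite psiK.
  by rewrite phiK.
rewrite -(on_card_preimset (onW_bij _ h_bij)); apply: eq_card => f; rewrite !inE.
congr (_ && _).
  have perm_phi : perm_eq (map phi (enum E)) (enum E').
    apply: uniq_perm; rewrite ?enum_uniq ?(map_inj_uniq (can_inj phiK)) ?enum_uniq //.
    by move=> y; rewrite mem_enum -[y]psiK map_f ?mem_enum.
  have -> : [seq val (h f x) | x <- enum E] = [seq val (f x) | x <- map phi (enum E)].
    by elim: (enum E) => //= x r ->; rewrite ffunE.
  by rewrite (permPl (perm_map _ perm_phi)).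
apply/'forall_forallP/'forall_forallP => H x y.
  by have := H (psi x) (psi y); rewrite !ffunE -C'phi !psiK.
by have := H (phi x) (phi y); rewrite !ffunE C'phi.
Qed.

Lemma card_cell_bij (E E' : finType) (g : E -> nat) (g' : E' -> nat) s K :
    (forall i, #|[set x | g x == i]| = #|[set x | g' x == i]|) ->
  #|cell g s K| = #|cell g' s K|.
Proof.
move=> /perm_map_enum_bij[phi phi_bij g'phi].
by apply: card_constrained_maps_bij phi_bij _ => x y i j; rewrite !g'phi.
Qed.

(* Reads the values 0, 1, 2, ... of [key] in increasing order and counts how
   often the parity switches, an odd parity being expected at the start. *)
Fixpoint alternations (E : finType) (key : E -> nat) (k : nat) : nat :=
  if k is k'.+1 then
    let c := alternations key k' in
    if [exists x, key x == k'] && (odd k' == odd c) then c.+1 else c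
  else 0.

Section Alternations.
Variables (E : finType) (key : E -> nat).
Let c := alternations key.

Lemma alternations_mono : {homo c : i j / i <= j}.
Proof.
apply: homo_leq => //; first exact: leq_trans.
by move=> i; rewrite /c /=; case: ifP.
Qed.

Lemma odd_alternations x : odd (c (key x).+1) = ~~ odd (key x).
Proof.
rewrite /c /= (introT existsP) /=; last by exists x.
case: ifP => /= [/eqP <- //|].
by case: (odd (key x)); case: (odd _).
Qed.

Lemma alternations_attained k i : 0 < i <= c k ->
  exists2 x, key x < k & c (key x).+1 = i.
Proof.
elim: k => [|k IHk]; rewrite /c /=; first by lia.
case: ifP => [/andP[/existsP[x /eqP kx] par]|_].
  move=> lei; have [eqi|nei] := eqVneq i (c k).+1; last first.
    have [|y lty eqy] := IHk; first by move: nei lei; rewrite /c; lia.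
    by exists y => //; apply: leqW.
  exists x; first by rewrite kx.
  by rewrite kx /c /= (introT existsP) ?par ?eqi //; exists x; apply/eqP.
by move=> lei; have [//|y lty eqy] := IHk; exists y => //; apply: leqW.
Qed.

(** Each increment is caused by an element not read before. The bound lets layers be stored in
    ['I_#|E|.+1]. *)
Lemma alternations_bound k : c k <= #|E|.
Proof.
apply: leq_trans (max_card [pred x | key x < k]).
elim: k => [|k IHk]; rewrite /c //=.
have sub : [pred x | key x < k] \subset [pred x | key x < k.+1].
  by apply/subsetP => x; rewrite !inE => /leqW.
case: ifP => [/andP[/existsP[x /eqP kx] _]|_]; last first.
  exact: leq_trans IHk (subset_leq_card sub).
apply: leq_ltn_trans IHk _; apply: proper_card; rewrite properE sub /=.
by apply/subsetPn; exists x; rewrite inE kx // ltnn.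
Qed.

End Alternations.

(** * Bipartite posets *)

Section Layerings.
Variables (E : finType) (B : {set E}) (R : rel E).

(* The ordered set partition (A_1, ..., A_m) is encoded as the map sending the
   elements of A_i to i - 1. *)
Definition layerings : {set {ffun E -> 'I_#|E|.+1}} :=
  [set g : {ffun E -> 'I_#|E|.+1} |
    [&& [forall x, odd (g x) == (x \notin B)],
        [forall x, forall y, R x y ==> (g x < g y)] &
        [forall x, forall i : 'I_#|E|.+1, (i < g x) ==> [exists y, g y == i]]]].

Lemma layeringsP (g : {ffun E -> 'I_#|E|.+1}) :
  reflect [/\ forall x, odd (g x) = (x \notin B),
              forall x y, R x y -> g x < g y &
              forall x i, i < g x -> exists y, g y = i :> nat]
          (g \in layerings).
Proof.
rewrite inE; apply: (iffP and3P) => -[H1 H2 H3]; split.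
- by move=> x; apply/eqP; apply: (forallP H1).
- by move=> x y; apply/implyP; apply: (forallP (forallP H2 x)).
- move=> x i lti; have ltiE := ltn_trans lti (ltn_ord (g x)).
  have /forallP /(_ (Ordinal ltiE)) /implyP /(_ lti) /existsP[y /eqP gy] := forallP H3 x.
  by exists y; rewrite gy.
- by apply/forallP => x; apply/eqP.
- by apply/forallP => x; apply/forallP => y; apply/implyP/H2.
apply/forallP => x; apply/forallP => i; apply/implyP => /H3[y gy].
by apply/existsP; exists y; apply/eqP/val_inj.
Qed.

Definition strict_maps := constrained_maps (fun x y i j => R x y ==> (i < j)).

Hypothesis R_bipartite : forall x y, R x y -> (x \in B) && (y \notin B).
Hypothesis R_covers : forall y, y \notin B -> exists x, R x y.

Variable K : nat.

(* Sorting by [layer_key f] sorts by [f], elements outside of B first. *)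
Definition layer_key (f : {ffun E -> 'I_K}) (x : E) : nat := 2 * f x + (x \in B).

Lemma odd_layer_key f x : odd (layer_key f x) = (x \in B).
Proof. by rewrite /layer_key oddD mul2n odd_double; case: (x \in B). Qed.

Lemma layer_key_lt (f : {ffun E -> 'I_K}) x y :
    (if (x \in B) && (y \notin B) then f x < f y else f x <= f y) ->
  (x \in B) != (y \in B) -> layer_key f x < layer_key f y.
Proof.
by rewrite /layer_key; case: (x \in B); case: (y \in B) => //= le_xy _; lia.
Qed.

(** For layers of opposite parity the cell inequalities yield the inequality of keys. For equal
    parity, pass through the layer just above that of [x], which is nonempty because [g] has no
    gaps. *)
Lemma cell_layer_key s (g : {ffun E -> 'I_#|E|.+1}) f :
    g \in layerings -> f \in cell (fun x => g x : nat) s K ->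
  forall x y, g x < g y -> layer_key f x < layer_key f y.
Proof.
move=> /layeringsP[g_odd g_R g_init]; rewrite inE => /andP[_ /'forall_forallP f_cell].
have step x y : g x < g y -> (x \in B) != (y \in B) -> layer_key f x < layer_key f y.
  move=> lt_xy; apply: layer_key_lt.
  by have := implyP (f_cell x y) lt_xy; rewrite !g_odd negbK.
move=> x y lt_xy; have [neB|eqB] := boolP ((x \in B) != (y \in B)); first exact: step.
have par : odd (g x) = odd (g y).
  by rewrite !g_odd; congr (~~ _); apply/eqP; rewrite negbK in eqB.
have [|z gz] := g_init y (g x).+1; first by move: lt_xy par; lia.
have parz : (x \in B) != (z \in B).
  by rewrite -[x \in B]negbK -g_odd -[z \in B]negbK -g_odd gz /=; case: odd.
apply: (@ltn_trans (layer_key f z)); apply: step => //; first by rewrite gz.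
  by move: lt_xy par; rewrite gz; lia.
by move: eqB parz; rewrite negbK => /eqP<-; rewrite eq_sym.
Qed.

(** Uniqueness of the layering, by induction on the key: an element [y] one layer below [x] for [g]
    satisfies [g' y <= g' x], and parity excludes equality. Exchanging [g] and [g'] gives the other
    inequality. *)
Lemma cell_layering_le s (g g' : {ffun E -> 'I_#|E|.+1}) f :
    g \in layerings -> g' \in layerings ->
    f \in cell (fun x => g x : nat) s K -> f \in cell (fun x => g' x : nat) s K ->
  forall x, g x <= g' x.
Proof.
move=> gL g'L fg fg' x.
have [g_odd _ g_init] := layeringsP _ gL; have [g'_odd _ _] := layeringsP _ g'L.
have [k] := ubnP (layer_key f x); elim: k x => // k IHk x ltk.
case gx: (nat_of_ord (g x)) => [//|j].
have [|y gy] := g_init x j; first by rewrite gx.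
have lt_yx : layer_key f y < layer_key f x.
  by apply: (cell_layer_key gL fg); rewrite gy gx.
have le_j : j <= g' y by rewrite -gy; apply: IHk; lia.
have le_yx : g' y <= g' x.
  rewrite leqNgt; apply/negP => /(cell_layer_key g'L fg').
  by rewrite ltnNge ltnW.
have par : odd (g' x) != odd (g' y).
  by rewrite !g'_odd -!g_odd gx gy /=; case: odd.
by move: par le_j le_yx; lia.
Qed.

Lemma layering_existence s f : f \in strict_maps s K ->
  exists2 g, g \in layerings & f \in cell (fun x => g x : nat) s K.
Proof.
rewrite inE => /andP[f_s /'forall_forallP f_R].
pose c := alternations (layer_key f).
(* The layer of [x] is the number of parity switches met up to and including its own key. *)
have c_bound x : c (layer_key f x).+1 < #|E|.+1 by rewrite ltnS alternations_bound.
pose g := [ffun x => Ordinal (c_bound x)].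
have gE x : g x = c (layer_key f x).+1 :> nat by rewrite ffunE.
have g_odd x : odd (g x) = (x \notin B).
  by rewrite gE odd_alternations odd_layer_key.
have g_le x y : g x < g y -> layer_key f x < layer_key f y.
  rewrite !gE; apply: contraTT; rewrite -!leqNgt => le_yx.
  by apply: alternations_mono; rewrite ltnS.
have g_R x y : R x y -> g x < g y.
  move=> xRy; have /andP[xB yB] := R_bipartite xRy.
  have lt_xy := implyP (f_R x y) xRy.
  have : g x <= g y.
    by rewrite leqNgt; apply/negP => /g_le; rewrite /layer_key xB (negbTE yB); lia.
  by rewrite leq_eqVlt => /predU1P[eq_g|//]; have := g_odd x; rewrite eq_g g_odd xB yB.
have g_attained x i : 0 < i <= g x -> exists y, g y = i :> nat.
  rewrite gE => /alternations_attained[y _ gy].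
  by exists y; rewrite gE.
have g_init x i : i < g x -> exists y, g y = i :> nat.
  case: i => [gx0|i /ltnW]; last exact: (g_attained x i.+1).
  (* Layer 0 is not empty: an element of layer 1 is outside [B], hence above some element of [B],
     whose layer is smaller. *)
  have [y gy] := g_attained x 1 gx0.
  have [|z zRy] := R_covers (y := y); first by rewrite -g_odd gy.
  by exists z; have := g_R _ _ zRy; rewrite gy; lia.
exists g; first by apply/layeringsP.
rewrite inE f_s; apply/'forall_forallP => x y; apply/implyP => /g_le.
by rewrite !g_odd negbK /layer_key; case: (x \in B); case: (y \in B) => /=; lia.
Qed.

Lemma cell_sub_strict_maps s (g : {ffun E -> 'I_#|E|.+1}) : g \in layerings ->
  cell (fun x => g x : nat) s K \subset strict_maps s K.
Proof.
move=> /layeringsP[g_odd g_R _]; apply/subsetP => f.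
rewrite !inE => /andP[-> /'forall_forallP f_cell]; apply/'forall_forallP => x y.
apply/implyP => xRy; have := implyP (f_cell x y) (g_R _ _ xRy).
by have /andP[xB yB] := R_bipartite xRy; rewrite !g_odd negbK xB yB.
Qed.

(** By existence and uniqueness of layerings the cells partition the strict maps; the equality
    counts pairs of a layering and a map in two ways. *)
Lemma card_strict_maps s :
  #|strict_maps s K| = \sum_(g in layerings) #|cell (fun x => g x : nat) s K|.
Proof.
pose gs := fun f : {ffun E -> 'I_K} =>
  [set g in layerings | f \in cell (fun x => g x : nat) s K].
have card_gs f : #|gs f| = (f \in strict_maps s K).
  have [fS|fS] := boolP (f \in strict_maps s K).
    have [g gL fg] := layering_existence fS.
    rewrite (_ : gs f = [set g]) ?cards1 //; apply/setP => g'.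
    rewrite /gs in_set in_set1; apply/andP/eqP => [[g'L fg']|-> //].
    apply/ffunP => x; apply/val_inj/anti_leq.
    by rewrite /= !(cell_layering_le _ _ fg fg', cell_layering_le _ _ fg' fg).
  apply/eqP; rewrite cards_eq0; apply/eqP/setP => g; rewrite /gs in_set in_set0.
  by apply: contraNF fS => /andP[gL]; apply: (subsetP (cell_sub_strict_maps s gL)).
rewrite -sum1_card; under [RHS]eq_bigr => g _ do rewrite -sum1_card.
rewrite [RHS](exchange_big_dep predT) //= [LHS]big_mkcond; apply: eq_bigr => f _.
rewrite sum1_card -[if _ then _ else _]/(nat_of_bool _) -(card_gs f).
by apply: eq_card => g; rewrite /gs in_set.
Qed.

End Layerings.

(** * Matroids *)

Section LayerSizes.
Variables (E : finType) (g : E -> nat).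

Definition layer_sizes : seq nat :=
  mkseq (fun i => #|[set x | g x == i]|) (\max_x (g x).+1).

Lemma nth_layer_sizes i : nth 0 layer_sizes i = #|[set x | g x == i]|.
Proof.
have [lti|lei] := ltnP i (\max_x (g x).+1); first by rewrite nth_mkseq.
rewrite nth_default ?size_mkseq //; apply/esym/eqP; rewrite cards_eq0.
apply/eqP/setP => x; rewrite !inE; apply: contraTF lei => /eqP <-.
by rewrite -ltnNge; apply: (@leq_bigmax _ (fun x => (g x).+1)).
Qed.

(** Taking all indices for [Q] gives the weight, taking the even ones gives the rank of the
    composition. *)
Lemma sum_layer_sizes (Q : pred nat) :
  \sum_(i < size layer_sizes | Q i) nth 0 layer_sizes i = #|[set x | Q (g x)]|.
Proof.
rewrite size_mkseq -[RHS]sum1_card.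
have ltg x : g x < \max_y (g y).+1 by apply: (@leq_bigmax _ (fun x => (g x).+1)).
rewrite [RHS](partition_big (fun x => Ordinal (ltg x)) (fun i => Q i)) => [|x];
  last by rewrite inE.
apply: eq_bigr => i Qi; rewrite nth_layer_sizes -sum1_card; apply: eq_bigl => x.
by rewrite !inE -val_eqE /= andb_idl // => /eqP ->.
Qed.

Lemma sumn_layer_sizes : sumn layer_sizes = #|E|.
Proof.
rewrite sumnE; have := sum_layer_sizes predT.
rewrite (big_nth 0) big_mkord => ->.
by rewrite -cardsT; apply: eq_card => x; rewrite !inE.
Qed.

Lemma layer_sizes_comp : (forall x i, i < g x -> exists y, g y = i) ->
  is_composition layer_sizes.
Proof.
move=> g_init; apply/(all_nthP 0) => i; rewrite nth_layer_sizes size_mkseq => lti.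
have [x lex] : exists x, i <= g x.
  have [x _ gx] : exists2 x, x \in E & i < (g x).+1.
    apply/exists_inP; apply: contraTT lti => /exists_inPn nx.
    by rewrite -leqNgt; apply/bigmax_leqP => x _; rewrite leqNgt; apply: nx.
  by exists x.
have [y gy] : exists y, g y = i.
  by move: lex; rewrite leq_eqVlt => /predU1P[->|/g_init //]; exists x.
by apply/card_gt0P; exists y; rewrite inE gy.
Qed.

Lemma N_qsym_layer_sizes K (e : exponents) :
    all (fun v => v < K) (exponent_word e) ->
  N_qsym layer_sizes e = (#|cell g (exponent_word e) K|)%:R%R.
Proof.
move=> eK; rewrite (N_qsymE _ eK); congr (_%:R)%R; apply: card_cell_bij => i.
by rewrite card_antichain_sum_tag nth_layer_sizes.
Qed.

End LayerSizes.

Section Matroid.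
Variables (E : finType) (M : matroid E).

(** Exchanging an element of [A :\: B] for one of [B :\: A] keeps the size of [A] and brings it
    closer to [B]. *)
Lemma bases_card A B : A \in bases M -> B \in bases M -> #|A| = #|B|.
Proof.
have [k] := ubnP #|A :\: B|; elim: k A => // k IHk A ltk AM BM.
have [AB0|[x xAB]] := set_0Vmem (A :\: B).
  have [BA0|[x xBA]] := set_0Vmem (B :\: A).
    by congr #|pred_of_set _|; apply/eqP; rewrite eqEsubset -!setD_eq0 AB0 BA0 eqxx.
  by have [y] := bases_exchange BM AM xBA; rewrite AB0 inE.
have [y yBA A'M] := bases_exchange AM BM xAB.
have /setDP[xA xB] := xAB; have /setDP[yB yA] := yBA.
rewrite -(IHk _ _ A'M BM).
  by rewrite cardsU1 (cardsD1 x A) xA !inE (negbTE yA) andbF.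
have lt : (y |: A :\ x) :\: B \proper A :\: B.
  apply/properP; split; last first.
    by exists x => //; rewrite !inE eqxx orbF andbC; case: eqP yA => // <-; rewrite xA.
  apply/subsetP => z; rewrite !inE => /andP[zB]; rewrite zB.
  by case/predU1P => [eq_zy|/andP[_ ->] //]; rewrite eq_zy yB in zB.
by have := proper_card lt; lia.
Qed.

Lemma matroid_rank_bases B : B \in bases M -> matroid_rank M = #|B|.
Proof.
move=> BM; apply/anti_leq/andP; split.
  apply/bigmax_leqP => I /exists_inP[A AM IA].
  by rewrite -(bases_card AM BM) subset_leq_card.
apply: (@leq_bigmax_cond _ _ (fun I : {set E} => #|I|)).
by apply/exists_inP; exists B.
Qed.

(** This is where looplessness enters: it provides the covering hypothesis [R_covers] for the order
    of [P_B]. *)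
Lemma loopless_exchange B y : loopless M -> B \in bases M -> y \notin B ->
  exists2 x, x \in B & y |: (B :\ x) \in bases M.
Proof.
move=> /(_ y) /exists_inP[A0 A0M]; rewrite sub1set => yA0 BM yB.
(* A basis through [y] meeting B as much as possible is B - x + y. *)
pose Q A := (A \in bases M) && (y \in A).
have QA0 : Q A0 by apply/andP.
have [A /andP[AM yA] A_max] := arg_maxnP (fun A => #|A :&: B|) QA0.
(* Any other element of [A :\: B] could be exchanged for one of [B :\: A], keeping [y] and enlarging
   the intersection with [B]. *)
have AB z : z \in A :\: B -> z = y.
  move=> zAB; apply/eqP; apply: contraT => z_y.
  have [t tBA A'M] := bases_exchange AM BM zAB.
  have /setDP[zA zB] := zAB; have /setDP[tB tA] := tBA.
  have /A_max : Q (t |: A :\ z) by rewrite /Q A'M !inE (eq_sym y z) z_y yA orbT.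
  rewrite /geq /= leqNgt => /negP[]; apply/proper_card/properP; split.
    apply/subsetP => u; rewrite !inE => /andP[uA uB]; rewrite uA uB !andbT.
    by apply/orP; right; apply: contraTneq uB => ->.
  by exists t; rewrite !inE ?eqxx ?tB // (negbTE tA).
have yAB : y \in A :\: B by rewrite inE yA yB.
(* This exchange only shows that [B :\: A] is nonempty; the next one removes [x] from [B] and can
   only bring in [y]. *)
have [x xBA _] := bases_exchange AM BM yAB.
have [z /AB -> BxyM] := bases_exchange BM AM xBA.
by exists x => //; case/setDP: xBA.
Qed.

End Matroid.

(** * The expansion of F(M) in the N-basis *)

Section Expansion.
Variables (E : finType) (M : matroid E).
Variable w : forall B : {set E}, basis_poset M B -> nat.
Hypothesis M_loopless : loopless M.
Hypothesis w_strict : forall B : {set E}, B \in bases M -> strict_labeling (@w B).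

Definition basis_layerings (B : {set E}) := layerings B (@basis_poset_lt E M B).

Lemma basis_poset_qsymE B : B \in bases M ->
  poset_qsym (@w B) =
    (\sum_(g in basis_layerings B) N_qsym (layer_sizes (fun x => g x : nat)))%R.
Proof.
move=> BM; apply: functional_extensionality_dep => e; rewrite series_sumE.
have [[w_inj _] w_lt] := w_strict BM.
pose K := (\max_(i <- exponent_word e) i).+1.
have eK : all (fun v => v < K) (exponent_word e).
  by apply/allP => i ie; rewrite ltnS /K; apply: leq_bigmax_seq.
rewrite (poset_qsymE w_inj eK).
under eq_bigr => g _ do rewrite (N_qsym_layer_sizes _ eK).
rewrite -natr_sum -card_strict_maps => [|x y|y yB].
- congr (_%:R)%R.
  apply: (@card_constrained_maps_bij (basis_poset M B) E id); first by exists id.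
  (* A strict labeling drops along the order, so equal values are excluded and the lexicographic
     condition becomes [i < j]. *)
  move=> x y i j; apply/esym/implyb_id2l => /w_lt lt_yx; rewrite /lexlt /=.
  by rewrite (leq_gtF (ltnW lt_yx)) andbF orbF.
- by case/and3P => -> ->.
by have [x xB xyM] := loopless_exchange M_loopless BM yB; exists x; apply/and3P.
Qed.

Definition layering_count (a : seq nat) : nat :=
  \sum_(B in bases M)
    #|[set g in basis_layerings B | layer_sizes (fun x => g x : nat) == a]|.

Lemma matroid_qsymE :
  matroid_qsym w =
    N_combination #|E| (matroid_rank M) (fun a => (layering_count a)%:R%R).
Proof.
rewrite /matroid_qsym /N_combination (eq_bigr _ basis_poset_qsymE).
under [RHS]eq_bigr => a _ do rewrite natr_sum scaler_suml.
rewrite exchange_big /=; apply: eq_bigr => B BM.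
under [RHS]eq_bigr => a _ do rewrite scaler_nat -sumr_const.
under [RHS]eq_bigr => a _.
  rewrite (eq_bigl (fun g => (g \in basis_layerings B) &&
    (layer_sizes (fun x => g x : nat) == a))); last by move=> g; rewrite in_set.
  over.
rewrite [RHS](exchange_big_dep (fun g => g \in basis_layerings B)) /=;
  last by move=> ? ? _ /andP[].
apply: eq_bigr => g gL; set b := layer_sizes _.
have [g_odd _ g_init] := layeringsP _ _ _ gL.
have b_comp : b \in compositions #|E|.
  by rewrite mem_compositions sumn_layer_sizes eqxx andbT layer_sizes_comp.
(* The layers of even index together form [B], whose cardinality is the rank of the matroid. *)
have b_rank : comp_rank b = matroid_rank M.
  rewrite (matroid_rank_bases BM) /comp_rank (sum_layer_sizes _ (fun i => ~~ odd i)).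
  by apply: eq_card => x; rewrite inE g_odd negbK.
rewrite (eq_bigl (fun a => a == b)) => [|a]; last first.
  by rewrite gL -/b /=; case: (eqVneq a b) => [->|]; rewrite ?b_rank ?eqxx ?andbF.
by rewrite -big_filter filter_pred1_uniq ?compositions_uniq // big_seq1.
Qed.

End Expansion.

(** * Linear independence *)

Lemma composition_eq a b : is_composition a -> is_composition b ->
  (forall j, sumn (take j a) = sumn (take j b)) -> a = b.
Proof.
elim: a b => [|x a IHa] [|y b] //=.
- by move=> _ /andP[y0 _] /(_ 1); rewrite /= take0; lia.
- by move=> /andP[x0 _] _ /(_ 1); rewrite /= take0; lia.
move=> /andP[_ ca] /andP[_ cb] eq_ab.
have eq_xy : x = y by have := eq_ab 1; rewrite /= !take0 /=; lia.
congr cons => //; apply: IHa => // j.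
by have := eq_ab j.+1; rewrite /= eq_xy => /addnI.
Qed.

Lemma leq_size_sumn a : is_composition a -> size a <= sumn a.
Proof. by elim: a => //= x a IHa /andP[x0 /IHa]; lia. Qed.

Lemma size_partial_sums a : size (partial_sums a) = (size a).-1.
Proof. by rewrite size_map size_iota. Qed.

Lemma nth_partial_sums a j : j.+1 < size a ->
  nth 0 (partial_sums a) j = sumn (take j.+1 a).
Proof.
by move=> ltj; rewrite (nth_map 0) ?size_iota ?nth_iota ?add1n //; lia.
Qed.

Lemma partial_sums_sorted a : is_composition a -> sorted ltn (partial_sums a).
Proof.
move=> ca; apply/(sortedP 0) => j; rewrite size_partial_sums => ltj.
rewrite !nth_partial_sums; try lia.
rewrite (sumn_takeS a j.+1) /=.
by have := @composition_nth_gt0 a j.+1 ca; lia.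
Qed.

(** The partial sums of the coarser composition form a subset of those of the finer one. This is the
    triangularity behind the independence of the fundamental functions. *)
Lemma refines_size a b : is_composition a -> is_composition b ->
  refines b a -> size a <= size b ?= iff (a == b).
Proof.
move=> ca cb /andP[/eqP eq_sum /allP sub].
have ua : uniq (partial_sums a).
  by apply: sorted_uniq (partial_sums_sorted ca); [exact: ltn_trans|exact: ltnn].
have size_gt0 c : is_composition c -> (0 < size c) = (0 < sumn c).
  by case: c => //= x c /andP[]; lia.
(* [partial_sums] does not separate the empty composition from those with one part; the weight
   does. *)
have sz0 : (0 < size a) = (0 < size b) by rewrite !size_gt0 // eq_sum.
have sub' : {subset partial_sums a <= partial_sums b} by move=> k /sub.
have le_ab : size a <= size b.
  by have := uniq_leq_size ua sub'; rewrite !size_partial_sums; lia.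
split=> //; apply/eqP/eqP => [eq_sz|-> //].
have [|_ eq_ps] := uniq_min_size ua sub'; first by rewrite !size_partial_sums eq_sz.
have {}eq_ps : partial_sums a = partial_sums b.
  by apply: (irr_sorted_eq ltn_trans ltnn); rewrite ?partial_sums_sorted.
apply: composition_eq => // -[|j]; first by rewrite !take0.
have [lej|ltj] := leqP (size a) j.+1.
  by rewrite !take_oversize -?eq_sz.
by rewrite -nth_partial_sums // eq_ps nth_partial_sums // -eq_sz.
Qed.

Lemma nonzero_exponents_surj a : is_composition a ->
  exists e : exponents, nonzero_exponents e = a.
Proof.
move=> ca.
pose e : exponents := [fsfun i in seq_fset tt (iota 0 (size a)) => nth 0 a i]%fset.
have eE i : e i = nth 0 a i.
  rewrite fsfun_fun seq_fsetE mem_iota add0n /=; case: ltnP => // lei.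
  by rewrite nth_default.
exists e; have -> : nonzero_exponents e = map (nth 0 a) (sort leq (finsupp e)).
  exact: eq_map.
have -> : sort leq (finsupp e) = iota 0 (size a).
  apply: (sorted_eq leq_trans anti_leq).
  - exact: sort_sorted leq_total _.
  - exact: iota_sorted.
  rewrite perm_sort; apply: uniq_perm; rewrite ?fset_uniq ?iota_uniq // => i.
  rewrite mem_finsupp eE mem_iota add0n /=; case: (ltnP i (size a)) => lti.
    by rewrite -lt0n composition_nth_gt0.
  by rewrite nth_default.
by rewrite map_nth_iota0 // take_size.
Qed.

Section FundamentalFree.
Local Open Scope ring_scope.

(** Induction on the number of parts: at the monomial with exponents [a], only [a] and compositions
    with fewer parts contribute. *)
Lemma fundamental_qsym_free n (d : seq nat -> rat) :
    \sum_(a <- compositions n) d a *: fundamental_qsym a = 0 ->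
  forall a, a \in compositions n -> d a = 0.
Proof.
move=> sum0 a; have [k] := ubnP (size a); elim: k a => // k IHk a ltk aC.
have := aC; rewrite mem_compositions => /andP[ca _].
have [e ea] := nonzero_exponents_surj ca.
have : (\sum_(b <- compositions n) d b *: fundamental_qsym b) e = 0 by rewrite sum0.
have coefE b : (d b *: fundamental_qsym b) e = d b * (refines a b)%:R :> rat.
  by rewrite -ea; exact: (congr1 (fun z : rat => d b * z) (fundamental_qsymE b e)).
have ref_aa : refines a a by rewrite /refines eqxx; apply/allP.
rewrite series_sumE (bigD1_seq a) ?compositions_uniq //= big_seq_cond big1 ?addr0.
  by rewrite coefE ref_aa mulr1.
move=> b /andP[bC ne_ba]; have := bC; rewrite mem_compositions => /andP[cb _].
rewrite coefE; have [ref_ab|_] := boolP (refines a b); last by rewrite mulr0.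
rewrite IHk ?mul0r //; have [le_ba eq_ba] := refines_size cb ca ref_ab.
have lt_ba : (size b < size a)%N by rewrite ltn_neqAle eq_ba ne_ba.
exact: leq_trans lt_ba ltk.
Qed.

End FundamentalFree.

(** * Expansion of N_alpha in the fundamental basis *)

Lemma card_antichain_sum a : #|antichain_sum a| = sumn a.
Proof.
rewrite card_tagged sumnE big_map big_enum /= [RHS]sumnE (big_nth 0) big_mkord.
by apply: eq_bigr => i _; rewrite card_ord.
Qed.

Lemma size_antichain_tuple a (t : #|antichain_sum a|.-tuple (antichain_sum a)) :
  size t = sumn a.
Proof. by rewrite size_tuple card_antichain_sum. Qed.

(** The coefficient of [L_b] in [N_a]. *)
Definition extension_count a b : nat :=
  #|[set t in linear_extensions (antichain_sum a) |
      run_composition (map (@antichain_sum_label a) t) == b]|.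

Lemma N_qsym_fundamental a :
  (N_qsym a = \sum_(b <- compositions (sumn a))
                (extension_count a b)%:R *: fundamental_qsym b)%R.
Proof.
rewrite /N_qsym /poset_qsym.
under [RHS]eq_bigr => b _ do rewrite scaler_nat -sumr_const.
rewrite [RHS](exchange_big_dep
  (fun t => t \in linear_extensions (antichain_sum a))) /=; last first.
  by move=> b t _; rewrite inE => /andP[].
apply: eq_bigr => t tL; set b0 := run_composition _.
rewrite (eq_bigl (fun b => b == b0)) => [|b]; last by rewrite in_set tL eq_sym.
rewrite -big_filter filter_pred1_uniq ?compositions_uniq ?big_seq1 //.
rewrite mem_compositions run_composition_comp sumn_run_composition size_map.
by rewrite size_antichain_tuple eqxx.
Qed.

Definition block_word (a : seq nat) := repeat_word (nth 0 a) (iota 0 (size a)).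

Lemma size_block_word a : size (block_word a) = sumn a.
Proof. by rewrite size_repeat_word map_nth_iota0 // take_size. Qed.

Lemma leq_nth_repeat_iota m i0 len k j : k < size (repeat_word m (iota i0 len)) ->
  (i0 + j <= nth 0 (repeat_word m (iota i0 len)) k) =
    (sumn (take j (map m (iota i0 len))) <= k).
Proof.
elim: len i0 k j => //= len IHlen i0 k j.
rewrite /repeat_word /= size_cat size_nseq nth_cat size_nseq -/(repeat_word _ _).
case: (ltnP k (m i0)) => [ltk _|lek ltk].
  by rewrite nth_nseq ltk; case: j => [|j] /=; lia.
have ltk' : k - m i0 < size (repeat_word m (iota i0.+1 len)) by lia.
case: j => [|j] /=.
  by rewrite addn0; have := IHlen i0.+1 _ 0 ltk'; rewrite take0 /=; lia.
by have := IHlen i0.+1 _ j ltk'; lia.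
Qed.

(** This adjunction between positions and block indices turns inequalities of partial sums into
    inequalities of words. *)
Lemma leq_block_word a k j : k < sumn a ->
  (j <= nth 0 (block_word a) k) = (sumn (take j a) <= k).
Proof.
move=> ltk; have := @leq_nth_repeat_iota (nth 0 a) 0 (size a) k j.
by rewrite -/(block_word a) size_block_word map_nth_iota0 // take_size; apply.
Qed.

(** Elements of different blocks are comparable, so tags increase weakly along [t]; their
    multiplicities are the block sizes, which fixes the word. *)
Lemma map_tag_extension a (t : #|antichain_sum a|.-tuple (antichain_sum a)) :
  t \in linear_extensions (antichain_sum a) ->
  map (fun x : antichain_sum a => tag x : nat) t = block_word a.
Proof.
rewrite inE => /andP[ut /'forall_forallP t_ext].
apply: (sorted_eq leq_trans anti_leq).
- rewrite sorted_map; case: (tval t) ut t_ext => // x0 s ut t_ext.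
  apply/(sortedP x0) => k ltk; rewrite /= leqNgt; apply/negP => lt_tag.
  have := implyP (t_ext (nth x0 (x0 :: s) k.+1) (nth x0 (x0 :: s) k)) lt_tag.
  by rewrite !index_uniq ?(ltnW ltk) //; lia.
- by apply: sorted_repeat_word; exact: iota_sorted.
apply: (@perm_trans _
  (map (fun x : antichain_sum a => tag x : nat) (enum (antichain_sum a)))).
  exact/perm_map/perm_tuple_enum.
apply/allP => i _ /=; rewrite count_map count_repeat_word ?iota_uniq // mem_iota add0n /=.
have -> : (if i < size a then nth 0 a i else 0) = nth 0 a i.
  by case: ltnP => // lei; rewrite nth_default.
rewrite -card_antichain_sum_tag cardE -size_filter enumT; apply/eqP; congr size.
by apply: eq_filter => x; rewrite /= inE.
Qed.

(** * The zigzag extension and its descents *)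

Section Zigzag.
Variable a : seq nat.

Definition zigzag_key (x : antichain_sum a) : nat :=
  if odd (tag x) then nth 0 a (tag x) - tagged x else tagged x.

(* The extension whose descents are the steps ending in an even-numbered A_i:
   it is increasing on A_1, A_3, ... and decreasing on A_2, A_4, ... *)
Definition zigzag_extension :=
  lexsort (fun x : antichain_sum a => tag x : nat) zigzag_key.

Definition zigzag_composition :=
  run_composition (map (@antichain_sum_label a) zigzag_extension).

Lemma zigzag_key_inj : injective (fun x : antichain_sum a => (tag x : nat, zigzag_key x)).
Proof.
move=> x y []; rewrite /zigzag_key => /val_inj eq_tag.
have ltx := ltn_ord (tagged x); have lty := ltn_ord (tagged y).
move=> eq_key; apply: antichain_sum_eq => //.
have eq_odd : odd (tag x) = odd (tag y) by rewrite eq_tag.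
have eq_part : nth 0 a (tag x) = nth 0 a (tag y) by rewrite eq_tag.
by move: eq_key; rewrite eq_odd; case: ifP => _; lia.
Qed.

Lemma zigzag_extensionP : zigzag_extension \in linear_extensions (antichain_sum a).
Proof.
rewrite inE lexsort_uniq; apply/'forall_forallP => x y; apply/implyP => lt_xy.
by rewrite (lexsort_index zigzag_key_inj); apply/orP; left.
Qed.

Lemma nth_map_label (t : #|antichain_sum a|.-tuple (antichain_sum a)) k :
    t \in linear_extensions (antichain_sum a) -> k < sumn a ->
  exists2 x, nth 0 (map (@antichain_sum_label a) t) k = antichain_sum_label x &
    nth 0 (block_word a) k = tag x /\ nth x t k = x.
Proof.
move=> tL ltk; have szt : size t = sumn a by rewrite size_antichain_tuple.
have /card_gt0P[x0 _] : 0 < #|antichain_sum a| by rewrite card_antichain_sum; lia.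
exists (nth x0 t k); rewrite ?(nth_map x0) ?szt //; split;
  last by apply: set_nth_default; rewrite szt.
by rewrite -(map_tag_extension tL) (nth_map x0) ?szt.
Qed.

(** Between blocks, ascents and descents are forced by the labeling, hence common to all
    extensions. *)
Lemma extension_step (t : #|antichain_sum a|.-tuple (antichain_sum a)) k :
    t \in linear_extensions (antichain_sum a) -> 0 < k < sumn a ->
    nth 0 (block_word a) k.-1 < nth 0 (block_word a) k ->
  let u := map (@antichain_sum_label a) t in
  (nth 0 u k.-1 < nth 0 u k) =
    ~~ (~~ odd (nth 0 (block_word a) k.-1) && odd (nth 0 (block_word a) k)).
Proof.
move=> tL /andP[k0 ltk] + u; rewrite /u.
have [|x -> [-> _]] := nth_map_label (k := k.-1) tL; first by lia.
have [y -> [-> _]] := nth_map_label tL ltk.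
move/antichain_sum_label_lt; case: (~~ odd _ && odd _) => //= lt_yx.
by rewrite (leq_gtF (ltnW lt_yx)).
Qed.

Hypothesis a_comp : is_composition a.

Lemma block_word_step k : 0 < k < sumn a ->
  nth 0 (block_word a) k.-1 <= nth 0 (block_word a) k <= (nth 0 (block_word a) k.-1).+1.
Proof.
move=> /andP[k0 ltk]; have ltk' : k.-1 < sumn a by lia.
apply/andP; split.
  by rewrite leq_block_word //; apply: leq_trans (leq_pred k); rewrite -leq_block_word.
set i := nth 0 _ k.-1.
have nle : ~~ (sumn (take i.+1 a) <= k.-1) by rewrite -leq_block_word // ltnn.
rewrite leqNgt leq_block_word // sumn_takeS.
have [lti|lei] := ltnP i.+1 (size a).
  by have := composition_nth_gt0 a_comp lti; lia.
by move: nle; rewrite take_oversize //; lia.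
Qed.

(** At a boundary the index grows by exactly one, so the parity of the new block decides; inside a
    block the zigzag key does. *)
Lemma zigzag_step k : 0 < k < sumn a ->
  let u := map (@antichain_sum_label a) zigzag_extension in
  (nth 0 u k.-1 < nth 0 u k) = ~~ odd (nth 0 (block_word a) k).
Proof.
move=> kn; have /andP[k0 ltk] := kn.
have /andP[le_w le_wS] := block_word_step kn.
have [lt_w|eq_w] := ltnP (nth 0 (block_word a) k.-1) (nth 0 (block_word a) k).
  move=> u; rewrite /u (extension_step zigzag_extensionP kn lt_w); congr (~~ _).
  have -> : nth 0 (block_word a) k = (nth 0 (block_word a) k.-1).+1 by lia.
  by rewrite /= andbb.
move=> u; rewrite /u.
have [|x ux [tx xk]] := nth_map_label (k := k.-1) zigzag_extensionP; first by lia.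
have [y uy [ty yk]] := nth_map_label zigzag_extensionP ltk.
have eq_tag : tag x = tag y by apply/val_inj; rewrite /= -tx -ty; lia.
rewrite ux uy antichain_sum_label_same_tag // ty.
have szz : size zigzag_extension = sumn a by rewrite size_antichain_tuple.
have /(sortedP x) /(_ k.-1) : sorted _ zigzag_extension := lexsort_sorted zigzag_key_inj.
rewrite szz prednK // => /(_ ltk).
rewrite xk (set_nth_default y) ?szz // yk.
rewrite /= /lexlt /= (_ : (tag x < tag y) = false) => [/andP[_]|];
  last by rewrite eq_tag ltnn.
have eq_odd : odd (tag x) = odd (tag y) by rewrite eq_tag.
have eq_part : nth 0 a (tag x) = nth 0 a (tag y) by rewrite eq_tag.
have ltx := ltn_ord (tagged x); have lty := ltn_ord (tagged y).
by rewrite /zigzag_key eq_odd; case: ifP => /=; lia.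
Qed.

End Zigzag.

(** An extension of [P_a] with the run composition of the zigzag extension of [b] has the same
    descents. Comparing them at the block boundaries of [a], where they are forced, gives a parity
    condition on the blocks of [b]. *)
Lemma zigzag_dominance a b : is_composition a -> is_composition b ->
    sumn a = sumn b -> 0 < extension_count a (zigzag_composition b) ->
  forall j, sumn (take j b) <= sumn (take j a).
Proof.
move=> ca cb eq_sum /card_gt0P[t]; rewrite in_set => /andP[tL /eqP eq_rc].
have parity k : 0 < k < sumn a ->
    nth 0 (block_word a) k.-1 < nth 0 (block_word a) k ->
    odd (nth 0 (block_word b) k) =
      ~~ odd (nth 0 (block_word a) k.-1) && odd (nth 0 (block_word a) k).
  move=> kn lt_w; apply: negb_inj; rewrite -(extension_step tL kn lt_w).
  have := mem_partial_sums_run (s := map (@antichain_sum_label a) t) (k := k).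
  rewrite size_map size_antichain_tuple => /(_ kn).
  rewrite eq_rc mem_partial_sums_run; last first.
    by rewrite size_map size_antichain_tuple -eq_sum.
  by move/negb_inj <-; rewrite zigzag_step // -eq_sum.
have lt_take j : j < size a -> sumn (take j a) < sumn a.
  move=> ltj; apply: leq_trans (leq_sumn_take a j.+1); rewrite sumn_takeS.
  by have := composition_nth_gt0 ca ltj; lia.
(* Dominance restated: where block [j] of [a] starts, the word of [b] has reached index at least
   [j]. *)
suff le_idx j : j < size a -> j <= nth 0 (block_word b) (sumn (take j a)).
  move=> j; have [lej|ltj] := leqP (size a) j.
    by rewrite [in leqRHS]take_oversize // eq_sum leq_sumn_take.
  by rewrite -leq_block_word ?le_idx // -eq_sum lt_take.
elim: j => // j IHj ltj; set k := sumn (take j.+1 a).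
have a_j := composition_nth_gt0 ca (ltnW ltj).
have k_j : k = sumn (take j a) + nth 0 a j by rewrite /k sumn_takeS.
have kn : 0 < k < sumn a by rewrite lt_take // andbT; lia.
have k1n : k.-1 < sumn a by lia.
have word_k1 : nth 0 (block_word a) k.-1 = j.
  apply/eqP; rewrite eqn_leq leqNgt !leq_block_word //; apply/andP; split; last by lia.
  by rewrite -/k; lia.
have word_k : nth 0 (block_word a) k = j.+1.
  have /andP[_ kN] := kn.
  apply/eqP; rewrite eqn_leq leqNgt !leq_block_word // leqnn andbT -ltnNge.
  by rewrite (sumn_takeS a j.+1) -/k; have := composition_nth_gt0 ca ltj; lia.
have := parity k kn; rewrite word_k1 word_k => /(_ (ltnSn _)) par.
(* Induction and monotonicity give index at least [j]; by [par] the index has the parity of [j.+1],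
   so [j] itself is excluded. *)
have : j <= nth 0 (block_word b) k.
  have le_jk : sumn (take j a) <= k by lia.
  have ltkb : k < sumn b by rewrite -eq_sum; case/andP: kn.
  have := IHj (ltnW ltj); rewrite !leq_block_word ?(leq_ltn_trans le_jk) //.
  by move/leq_trans; apply.
by rewrite leq_eqVlt => /predU1P[eq_j|//]; move: par; rewrite -eq_j /=; case: odd.
Qed.

Section NFree.
Local Open Scope ring_scope.

Lemma N_qsym_free n (c : seq nat -> rat) :
    \sum_(a <- compositions n) c a *: N_qsym a = 0 ->
  forall a, a \in compositions n -> c a = 0.
Proof.
move=> sum0.
have coef0 b : b \in compositions n ->
    \sum_(a <- compositions n) c a * (extension_count a b)%:R = 0.
  move: b; apply: fundamental_qsym_free; rewrite -[RHS]sum0.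
  under eq_bigr => b _ do rewrite scaler_suml.
  rewrite exchange_big /=; apply: eq_big_seq => a.
  rewrite mem_compositions => /andP[_ /eqP sum_a].
  rewrite N_qsym_fundamental sum_a scaler_sumr; apply: eq_bigr => b _.
  by rewrite scalerA.
(* [nu] decreases strictly when a composition of [n] is replaced by one that strictly dominates it.
   In the equation for [zigzag_composition b] only compositions dominating [b] occur, so induction
   on [nu] leaves the term of [b]. *)
pose nu b := (\sum_(j < n.+1) (n - sumn (take j b)))%N.
move=> b; have [k] := ubnP (nu b); elim: k b => // k IHk b ltk bC.
have := bC; rewrite mem_compositions => /andP[cb /eqP sum_b].
have zC : zigzag_composition b \in compositions n.
  rewrite mem_compositions run_composition_comp sumn_run_composition size_map.
  by rewrite size_antichain_tuple sum_b eqxx.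
have := coef0 _ zC; rewrite (bigD1_seq b) ?compositions_uniq //= big_seq_cond big1 ?addr0.
  move/eqP; rewrite mulf_eq0 => /orP[/eqP //|]; rewrite pnatr_eq0 cards_eq0 => /eqP/setP.
  move/(_ (zigzag_extension b)); rewrite !inE eqxx andbT.
  by have := zigzag_extensionP b; rewrite inE => ->.
move=> a /andP[aC ne_ab]; have := aC; rewrite mem_compositions => /andP[ca /eqP sum_a].
have [-> |] := posnP (extension_count a (zigzag_composition b)); first by rewrite mulr0.
move=> /(zigzag_dominance ca cb); rewrite sum_a sum_b => /(_ erefl) dom.
rewrite IHk ?mul0r //; rewrite ltnS in ltk; apply: leq_trans ltk.
have [le_nu eq_nu] : (nu a <= nu b ?= iff
    [forall j : 'I_n.+1, n - sumn (take j a) == n - sumn (take j b)])%N.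
  by apply: leqif_sum => j _; apply: leqif_eq; apply: leq_sub2l.
rewrite ltn_neqAle le_nu eq_nu andbT; apply: contra ne_ab => /forallP eq_take.
apply/eqP/composition_eq => // j; have [lej|ltj] := leqP n j.
  have take_all d : is_composition d -> sumn d = n -> take j d = d.
    by move=> cd sd; rewrite take_oversize // (leq_trans (leq_size_sumn cd)) ?sd.
  by rewrite !take_all // sum_a sum_b.
have := eq_take (Ordinal (ltnW ltj : j < n.+1)%N) => /= /eqP.
by have := leq_sumn_take a j; have := leq_sumn_take b j; rewrite sum_a sum_b; lia.
Qed.

End NFree.

Lemma N_combination_inj n r (c d : seq nat -> rat) :
    N_combination n r c = N_combination n r d ->
  forall a, a \in compositions n -> comp_rank a = r -> c a = d a.
Proof.
move=> eq_cd a aC rank_a.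
(* Extending the difference by zero to other ranks allows independence over all compositions of [n]
   to be used. *)
pose f b := if comp_rank b == r then (c b - d b)%R else 0%R.
suff : f a = 0%R by rewrite /f rank_a eqxx => /eqP; rewrite subr_eq0 => /eqP.
apply: (N_qsym_free _ aC); transitivity (N_combination n r c - N_combination n r d)%R.
  rewrite /N_combination -sumrB [RHS]big_mkcond; apply: eq_bigr => b _.
  by rewrite /f -scalerBl; case: ifP; rewrite ?scale0r.
by rewrite eq_cd subrr.
Qed.

Local Open Scope ring_scope.

Theorem theorem5p2 (E : finType) (M : matroid E) (r n : nat)
    (w : forall B : {set E}, basis_poset M B -> nat)
    (M_loopless : loopless M)
    (rank_M : matroid_rank M = r)
    (card_E : #|E| = n)
    (w_strict : forall B : {set E}, B \in bases M -> strict_labeling (w B)) :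
  V n r (matroid_qsym w) /\
  (forall c : seq nat -> rat, matroid_qsym w = N_combination n r c ->
     forall a : seq nat, a \in compositions n -> comp_rank a = r ->
       c a \is a Num.nat).
Proof.
have := matroid_qsymE M_loopless w_strict; rewrite rank_M card_E => eq_M.
split; first by exists (fun a => (layering_count M a)%:R).
move=> c eq_c a aC rank_a.
(* Uniqueness transfers integrality and nonnegativity from [layering_count] to an arbitrary [c]. *)
have eq_cd := etrans (esym eq_c) eq_M.
by rewrite (N_combination_inj eq_cd aC rank_a) natr_nat.
Qed.
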